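(* (1) Every separable regular non-normal countably compact space $X$ can be embedded (i.e. is homeomorphic to a subspace) into a regular separable countably compact $\mathbb{R}$-rigid space $R(X)$. (2) Every separable regular non-normal totally countably compact space $X$ can be embedded into a regular separable totally countably compact $\mathbb{R}$-rigid space $R(X)$.
   Context: Regular spaces are assumed to be $T_1$. A space $X$ is $Y$-rigid if every continuous map $f:X\to Y$ is constant. A space $X$ is totally countably compact if each infinite set in $X$ contains an infinite subset whose closure in $X$ is compact. *)

(* Defs.v *)
From mathcomp Require Import all_boot all_algebra.
From mathcomp Require Import all_classical all_reals all_analysis.
Import numFieldNormedType.Exports.

Set Implicit Arguments.
Unset Strict Implicit.
Unset Printing Implicit Defensive.

Local Open Scope classical_set_scope.

(* The library's [regular_space] does not include the T1 axiom. *)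
Definition regular_T1_space (T : topologicalType) : Prop :=
  @accessible_space T /\ @regular_space T.

Definition separable_space (T : topologicalType) : Prop :=
  exists2 D : set T, countable D & dense D.

Definition countably_compact_space (T : topologicalType) : Prop :=
  forall U : nat -> set T, (forall n, open (U n)) ->
    [set: T] `<=` \bigcup_n U n -> finite_subset_cover [set: nat] U [set: T].

Definition totally_countably_compact_space (T : topologicalType) : Prop :=
  forall A : set T, infinite_set A ->
    exists B : set T, [/\ B `<=` A, infinite_set B & compact (closure B)].

Definition rigid_space (Y T : topologicalType) : Prop :=
  forall f : T -> Y, continuous f -> exists c : Y, forall x : T, f x = c.

Definition homeomorphic (S T : topologicalType) : Prop :=
  exists (f : S -> T) (g : T -> S),
    [/\ continuous f, continuous g, cancel f g & cancel g f].

(* [set_type A] carries the subspace topology, i.e. the initial topology of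
   the inclusion. *)
Definition embeds_in (S T : topologicalType) : Prop :=
  exists A : set T, homeomorphic S (set_type A).

(* Main.v *)
(** Let p and q be points of a regular, separable, totally countably compact
space J such that g p = g q for every continuous g : J -> R. In J^nat let the
k-th letter of a word be forgotten when the next letter is q and all later ones
are p. If all letters of w after the k-th are p, then changing the (k+1)-st
from p to q does not change the value of a continuous function, and after this
change the k-th letter does not matter. So the value at w is the value at the
word p, p, p, ...; such w are dense, and the quotient G of J^nat is R-rigid.
Since countable products of totally countably compact spaces are totally
countably compact, so is G. Finally X embeds in the cone X * G / X * {g0},
which is rigid because every {x} * G is and all of them share the vertex.

J is Jones' machine: copies of a non-normal T indexed by the integers, glued
alternately along two closed sets H and L of T, with one end point added on each
side; if a continuous function distinguished the ends, an alternating sum of its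
restrictions to finitely many copies would separate H from L. For T one takes
the square of the Cech-Stone compactification of nat with the corner (u, u)
removed, u a free ultrafilter, and the two edges {u} * _ and _ * {u}: no
sequence of points different from u converges to u, which makes T totally
countably compact. A power of X itself need not be countably compact, which is
why T is not taken to be X.

All identifications are encoded by topologies that are not T0, followed by a
single Kolmogorov quotient. *)

From HB Require Import structures.
Require Import Defs.
From mathcomp Require Import all_boot all_order all_algebra.
From mathcomp Require Import all_classical all_reals all_analysis.
From mathcomp Require Import zify ring lra.
Import Order.TTheory GRing.Theory Num.Theory.
Import numFieldNormedType.Exports.

Set Implicit Arguments.
Unset Strict Implicit.
Unset Printing Implicit Defensive.

Local Open Scope classical_set_scope.

(** * Topologies from filters attached to points *)

(* Open sets are the sets belonging to [N s] for each of their points [s]; the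
   sets in [N s] need not contain [s] and need not be neighbourhoods. *)
Definition from_nbhs (S : Type) (N : S -> set_system S)
  (FN : forall s, Filter (N s)) : Type := S.

Section FromNbhs.
Variables (S : Type) (N : S -> set_system S) (FN : forall s, Filter (N s)).
Local Notation T := (from_nbhs FN).

Let op (A : set T) := forall s, A s -> N s A.

Let opT : op setT.
Proof. by move=> s _; exact: filterT. Qed.

Let opI : setI_closed op.
Proof. by move=> A B oA oB s [/oA ? /oB ?]; exact: filterI. Qed.

Let op_bigU (I : Type) (f : I -> set T) :
  (forall i, op (f i)) -> op (\bigcup_i f i).
Proof.
move=> fo s [i _ fis]; apply: filterS (fo i s fis).
exact: bigcup_sup.
Qed.

HB.instance Definition _ := gen_eqMixin T.
HB.instance Definition _ := gen_choiceMixin T.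
HB.instance Definition _ := isOpenTopological.Build T opT opI op_bigU.

Lemma from_nbhs_openE (A : set T) : open A = forall s, A s -> N s A.
Proof. by []. Qed.

End FromNbhs.

(** * Regular spaces *)

Section Regularity.
Variable T : topologicalType.

(** A [from_nbhs] topology describes its open sets directly, its neighbourhoods and closures only
    through them; hence this form with open and closed sets. *)
Lemma regular_spaceP : regular_space T <->
  forall (x : T) A, open A -> A x ->
    exists O F : set T, [/\ open O, O x, O `<=` F, closed F & F `<=` A].
Proof.
split=> [reg x A oA Ax|reg x A].
  have [B xB BA] := reg x A (open_nbhs_nbhs (conj oA Ax)).
  exists B°, (closure B); split=> //; first exact: open_interior.
  - by apply: subset_trans (@subset_closure _ B); exact: interior_subset.
  - exact: closed_closure.
rewrite {1}nbhsE => -[U [oU Ux] UA].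
have [V [F [oV Vx VsF cF FU]]] := reg x U oU Ux.
exists V; first exact: open_nbhs_nbhs (conj oV Vx).
apply: subset_trans UA; apply: subset_trans FU.
by rewrite (closure_id F).1 //; exact: closureS.
Qed.

Lemma regular_nbhs (x : T) A : regular_space T -> nbhs x A ->
  exists2 C, closed C & nbhs x C /\ C `<=` A.
Proof.
move=> reg /reg[B xB BA]; exists (closure B); first exact: closed_closure.
by split=> //; apply: filterS xB; exact: subset_closure.
Qed.

Lemma regular_T1_hausdorff : regular_T1_space T -> hausdorff_space T.
Proof.
move=> [T1 reg] x y xy; apply: contrapT => /eqP nxy.
have [A [oA /set_mem Ax /set_mem nAy]] := T1 _ _ nxy.
have [C cC [xC CA]] := regular_nbhs reg (open_nbhs_nbhs (conj oA Ax)).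
have [z [Cz nCz]] : C `&` ~` C !=set0.
  by apply: xy xC _; apply: open_nbhs_nbhs; split;
    [exact: closed_openC|move=> /CA].
exact: nCz.
Qed.

End Regularity.

(** * Dense sequences and total countable compactness through sequences *)

Definition sequence_dense (T : topologicalType) (d : nat -> T) :=
  forall O, open O -> O !=set0 -> exists n, O (d n).

(** The sequential form of total countable compactness. It suits diagonal arguments and spaces that
    are not T0, where a compact [K] may fail to be closed. *)
Definition subsequence_compact (T : topologicalType) :=
  forall x : nat -> T, exists (phi : nat -> nat) (K : set T),
    [/\ {homo phi : m n / (m < n)%N}, compact K & forall n, K (x (phi n))].

Lemma homo_ltn_id_le (phi : nat -> nat) :
  {homo phi : m n / (m < n)%N} -> forall n, (n <= phi n)%N.
Proof. by move=> hphi; elim=> // n IH; apply: leq_ltn_trans IH _; exact: hphi. Qed.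

Lemma frequently_subsequence (M : set nat) :
  (forall N, exists2 n, (N <= n)%N & M n) ->
  exists2 phi : nat -> nat, {homo phi : m n / (m < n)%N} & forall n, M (phi n).
Proof.
move=> Mf; have nxt (n : nat) : {m | (n < m)%N /\ M m}.
  by apply: cid; have [m] := Mf n.+1; exists m.
have [m _ Mm] := Mf 0%N.
have [phi [phi0 phiS]] :=
  @dependent_choice nat (fun n m => (n < m)%N /\ M m) nxt m.
exists phi; last by case=> [|n]; [rewrite phi0|have [] := phiS n].
apply: homo_ltn => [|n]; first exact: ltn_trans.
by have [] := phiS n.
Qed.

(** A finite range is itself compact. An infinite subset of the range is met infinitely often,
    because finitely many terms give only finitely many points. *)
Lemma subsequence_compact_of_totally (T : topologicalType) :
  hausdorff_space T ->
  totally_countably_compact_space T -> subsequence_compact T.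
Proof.
move=> hT tT x.
have [finx|infx] := pselect (finite_set (range x)).
  by exists id, (range x); split=> //; exact: finite_compact.
have [B [Bx infB cB]] := tT _ infx.
have [|phi hphi phiB] := @frequently_subsequence (x @^-1` B).
  move=> N; apply: contrapT => nN; apply: infB.
  apply: (@sub_finite_set _ _ (x @` `I_N)); last exact/finite_image/finite_II.
  move=> b Bb; have [n _ xn] := Bx b Bb; exists n => //=.
  rewrite ltnNge; apply/negP => Nn; apply: nN; exists n => //=.
  by rewrite xn.
exists phi, (closure B); split=> // n; exact/subset_closure/phiB.
Qed.

Lemma infinite_injection (T : Type) (A : set T) : infinite_set A ->
  exists2 x : nat -> T, injective x & forall n, A (x n).
Proof.
elim/Ppointed: T => T in A *.
  by move=> /infinite_setN0[t]; case: (no t).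
move=> /infiniteP/ppcard_leP[f]; exists f; last by move=> n; exact: funS.
by move=> m n fmn; apply: (@inj _ _ _ f) => //; rewrite in_setT.
Qed.

(** An injective sequence in [A] has infinite range along [phi]; in a Hausdorff space [K] is closed
    and so contains the closure of that range. *)
Lemma totally_of_subsequence_compact (T : topologicalType) :
  hausdorff_space T ->
  subsequence_compact T -> totally_countably_compact_space T.
Proof.
move=> hT sT A /infinite_injection[x xI Ax].
have [phi [K [hphi cK Kx]]] := sT x.
have phiI : injective (x \o phi).
  move=> m n /= /xI phimn.
  by have [/hphi|/hphi|] := ltngtP m n; rewrite /= ?phimn ?ltnn.
exists (range (x \o phi)); split.
- by move=> _ [n _ <-]; exact: Ax.
- rewrite (eq_finite_set (@inj_card_eq _ _ setT (x \o phi) _)).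
    exact: infinite_nat.
  by move=> m n _ _; exact: phiI.
- have /closure_id Kcl := compact_closed hT cK.
  apply: (subclosed_compact _ cK); first exact: closed_closure.
  by rewrite Kcl; apply: closureS => _ [n _ <-]; exact: Kx.
Qed.

Lemma filter_forall_ltn (T : Type) (F : set_system T) (A : nat -> set T) m :
  Filter F -> (forall i, (i < m)%N -> F (A i)) ->
  F [set x | forall i, (i < m)%N -> A i x].
Proof.
move=> FF; elim: m => [|m IH] FA; first by apply: filterE.
have FAm : F [set x | forall i, (i < m)%N -> A i x].
  by apply: IH => i im; apply: FA; rewrite ltnS ltnW.
apply: filterS (filterI FAm (FA m (ltnSn m))) => x [Ax Amx] i.
by rewrite ltnS leq_eqVlt => /predU1P[->//|]; exact: Ax.
Qed.

(** Otherwise the preimage of the complement of [f b] is an open set with [a] but without [b]. This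
    gives glued points equal values. *)
Lemma continuous_indistinguishable (R : realType) (T : topologicalType)
    (f : T -> R) (a b : T) : continuous f ->
  (forall A, open A -> A a -> A b) -> f a = f b.
Proof.
move=> /continuousP cf ab; apply: contrapT => nf.
have : open (f @^-1` [set~ f b]).
  apply/cf/closed_openC/accessible_closed_set1/hausdorff_accessible.
  exact: Rhausdorff.
by move=> /ab /(_ nf); exact.
Qed.

(** * A nonseparated pair of closed sets in a plank *)

Section Ultrafilters.
Local Open Scope nat_scope.

Lemma ultra_of_dichotomy (T : Type) (F : set_system T) : ProperFilter F ->
  (forall A, F A \/ F (~` A)) -> UltraFilter F.
Proof.
move=> FF dF; split=> // G FG sFG; apply/seteqP; split=> // A GA.
have [//|/sFG GnA] := dF A; exfalso; apply: (@filter_not_empty _ G).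
by rewrite -(setICr A); exact: filterI.
Qed.

Lemma ultra_neq (T : Type) (F G : set_system T) :
  UltraFilter F -> UltraFilter G -> F <> G -> exists2 A, F A & ~ G A.
Proof.
move=> FU GU nFG; apply: contrapT => nA; apply: nFG; apply/esym.
apply: max_filter => A FA; apply: contrapT => nGA; apply: nA.
by exists A.
Qed.

Lemma ultra_setC (T : Type) (F : set_system T) A :
  UltraFilter F -> ~ F A -> F (~` A).
Proof. by move=> FU nFA; have [] := in_ultra_setVsetC A FU. Qed.

Definition at_point (n : nat) : set_system nat := [set A | A n].

Lemma at_point_ultra n : UltraFilter (at_point n).
Proof.
apply: ultra_of_dichotomy => [|A]; last exact: EM.
split; first by [].
by split=> [//|A B|A B AB]; [split|exact: AB].
Qed.

(** This is the image of [F] under [f]. *)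
Lemma ultra_pullback (T : Type) (F : set_system nat) (f : nat -> T) :
  UltraFilter F -> UltraFilter [set A | F (f @^-1` A)].
Proof.
move=> FU; apply: ultra_of_dichotomy => A.
exact: (in_ultra_setVsetC (f @^-1` A)).
Qed.

(* If every set of [u] were in almost all [a l], one could choose [a (l k)]
   and pairwise disjoint sets [C k] in [a (l k)]; neither the union of the
   [C k] with [k] even nor its complement could then be in [u]. *)
Lemma ultra_avoid (u : set_system nat) (a : nat -> set_system nat) :
  UltraFilter u -> (forall l, UltraFilter (a l)) -> (forall l, a l <> u) ->
  exists (phi : nat -> nat) (C : set nat),
    [/\ {homo phi : m n / m < n}, u C & forall n, ~ a (phi n) C].
Proof.
move=> uU aU nau; apply: contrapT => nphi.
have ev C : u C -> exists N, forall l, N <= l -> a l C.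
  move=> uC; apply: contrapT => nN; apply: nphi.
  have [|phi hphi phiC] := @frequently_subsequence [set l | ~ a l C].
    move=> N; apply: contrapT => nl; apply: nN; exists N => l Nl.
    by apply: contrapT => nal; apply: nl; exists l.
  by exists phi, C.
have nxt (s : {s : set nat * nat | u s.1}) : {s' : {s : set nat * nat | u s.1} |
    [/\ (sval s').1 `<=` (sval s).1, (sval s).2 < (sval s').2
      & a (sval s').2 ((sval s).1 `\` (sval s').1)]}.
  case: s => -[E b] /= uE; apply: cid.
  have [N NE] := ev E uE; pose l := maxn N b.+1.
  (* Cutting [A] off from [E] leaves a set of [u], while the part lost is in [a l]. *)
  have [A alA nuA] := ultra_neq (aU l) uU (nau l).
  have uEA : u (E `\` A) by apply: filterI => //; exact: ultra_setC.
  exists (exist _ (E `\` A, l) uEA); split=> /=; first exact: subDsetl.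
    exact: leq_maxr.
  apply: filterS (filterI (NE l (leq_maxl _ _)) alA) => n [En An].
  by split=> // -[].
have uT : u setT by exact: filterT.
have [s [_ sS]] := dependent_choice nxt (exist _ (setT, 0) uT).
pose E k := (sval (s k)).1; pose l k := (sval (s k)).2.
pose C k := E k `\` E k.+1.
have uE k : u (E k) by exact: (svalP (s k)).
have Edec i j : i <= j -> E j `<=` E i.
  elim: j => [|j IH]; first by rewrite leqn0 => /eqP ->.
  rewrite leq_eqVlt => /predU1P[->//|]; rewrite ltnS => /IH.
  by apply: subset_trans; have [] := sS j.
have lge k : k <= l k.
  by elim: k => // k IH; apply: leq_ltn_trans IH _; have [] := sS k.
have Cdisj i j n : C i n -> C j n -> i = j.
  move=> [Ein nEi] [Ejn nEj]; apply/eqP; rewrite eqn_leq.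
  apply/andP; split; rewrite leqNgt; apply/negP => ij.
    by apply: nEj; exact: (Edec _ _ ij).
  by apply: nEi; exact: (Edec _ _ ij).
pose B := \bigcup_(k in [set k | ~~ odd k]) C k.
have aC k : a (l k.+1) (C k) by have [] := sS k.
have [uB|uB] := in_ultra_setVsetC B uU; have [N NB] := ev _ uB.
  (* The piece [C] of odd index [N.*2.+1] misses [B], yet both lie in one ultrafilter [a l] with
     [N <= l]. *)
  have aB : a (l (N.*2.+1).+1) B by apply: NB; have := lge (N.*2.+2); lia.
  have [n [[k /= ko Ck] Cn]] := filter_ex (filterI aB (aC _)).
  by move: ko; rewrite (Cdisj _ _ _ Ck Cn) /= odd_double.
have aB : a (l (N.*2).+1) (~` B) by apply: NB; have := lge (N.*2.+1); lia.
have [n [nBn Cn]] := filter_ex (filterI aB (aC _)).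
by apply: nBn; exists N.*2 => //=; rewrite odd_double.
Qed.

End Ultrafilters.

Section Plank.
Variable u : set_system nat.

Record plank_point := PlankPoint {
  fst_ultra : set_system nat;
  snd_ultra : set_system nat;
  fst_ultraP : UltraFilter fst_ultra;
  snd_ultraP : UltraFilter snd_ultra;
  plank_neq : ~ (fst_ultra = u /\ snd_ultra = u) }.

Definition box (C D : set nat) : set plank_point :=
  [set t | fst_ultra t C /\ snd_ultra t D].

Definition plank_nbhs (t : plank_point) : set_system plank_point :=
  [set A | exists C D, box C D t /\ box C D `<=` A].

Lemma plank_filter t : Filter (plank_nbhs t).
Proof.
have F1 := fst_ultraP t; have F2 := snd_ultraP t.
split.
- by exists setT, setT; split=> //; split; exact: filterT.
- move=> A B [C [D [[tC tD] CDA]]] [C' [D' [[tC' tD'] CDB]]].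
  exists (C `&` C'), (D `&` D'); split; first by split; exact: filterI.
  move=> t' []; have F3 := fst_ultraP t'; have F4 := snd_ultraP t'.
  move=> tCC tDD; split; [apply: CDA|apply: CDB]; split.
  + by apply: filterS tCC => ? [].
  + by apply: filterS tDD => ? [].
  + by apply: filterS tCC => ? [].
  + by apply: filterS tDD => ? [].
- move=> A B AB [C [D [tCD CDA]]]; exists C, D; split=> //.
  exact: subset_trans AB.
Qed.

Definition plank := from_nbhs plank_filter.

Lemma open_box C D : open (box C D : set plank).
Proof. by rewrite from_nbhs_openE => t tCD; exists C, D; split. Qed.

Lemma closed_box C D : closed (box C D : set plank).
Proof.
rewrite -openC from_nbhs_openE => t ntCD.
have F1 := fst_ultraP t; have F2 := snd_ultraP t.
have [tC|tnC] := in_ultra_setVsetC C F1; last first.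
  exists (~` C), setT; split; first by split=> //; exact: filterT.
  move=> t' [t'nC _] [t'C _]; have F3 := fst_ultraP t'.
  by have [n []] := filter_ex (filterI t'nC t'C).
have [tD|tnD] := in_ultra_setVsetC D F2; first by exfalso; exact: ntCD.
exists setT, (~` D); split; first by split=> //; exact: filterT.
move=> t' [_ t'nD] [_ t'D]; have F4 := snd_ultraP t'.
by have [n []] := filter_ex (filterI t'nD t'D).
Qed.

Lemma plank_regular : regular_space plank.
Proof.
apply/regular_spaceP => t A oA At; have [C [D [tCD CDA]]] := oA t At.
by exists (box C D), (box C D); split=> //; [exact: open_box|exact: closed_box].
Qed.

Definition top_edge : set plank := [set t | snd_ultra t = u].
Definition right_edge : set plank := [set t | fst_ultra t = u].

Lemma edges_disjoint : top_edge `&` right_edge = set0.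
Proof. by apply/seteqP; split=> // t [t2 t1]; exact: (@plank_neq t (conj t1 t2)). Qed.

Hypothesis uU : UltraFilter u.

Lemma closed_top_edge : closed top_edge.
Proof.
rewrite -openC from_nbhs_openE => t nt2.
have [D tD nuD] := ultra_neq (snd_ultraP t) uU nt2.
have F1 := fst_ultraP t.
exists setT, D; split; first by split=> //; exact: filterT.
by move=> t' [_ t'D] t'2; apply: nuD; rewrite -t'2.
Qed.

Lemma closed_right_edge : closed right_edge.
Proof.
rewrite -openC from_nbhs_openE => t nt1.
have [C tC nuC] := ultra_neq (fst_ultraP t) uU nt1.
have F2 := snd_ultraP t.
exists C, setT; split; first by split=> //; exact: filterT.
by move=> t' [t'C _] t'1; apply: nuC; rewrite -t'1.
Qed.

(** The whole square is compact, and the removed box is an open neighbourhood of the missing corner,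
    so no limit can fall there. *)
Lemma compact_setC_box C : u C -> compact (~` box C C : set plank).
Proof.
move=> uC; rewrite compact_ultra => G GU GC.
(* The coordinates of the limit of [G]: those [E] that belong to the coordinate [f t] for [G]-almost
   all [t]. *)
have pull (f : plank -> set_system nat) : (forall t, UltraFilter (f t)) ->
    UltraFilter [set E | G [set t | f t E]].
  move=> fU; apply: ultra_of_dichotomy => [|E]; last first.
    have [?|GE] := in_ultra_setVsetC [set t | f t E] GU; [by left|right].
    by apply: filterS GE => t /= /ultra_setC; exact.
  split.
    move=> /= /filter_ex[t ft0]; have := fU t => FU.
    exact: filter_not_empty ft0.
  split=> [|E E' GE GE'|E E' EE'] /=.
  - by apply: (@filterE _ G) => t; have := fU t => FU; exact: filterT.
  - apply: (@filterS _ G _ _ _ _ (@filterI _ G _ _ _ GE GE')) => t [].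
    by have := fU t => FU; exact: filterI.
  - by apply: (@filterS _ G) => t; have := fU t => FU; exact: filterS.
have v1 := pull _ fst_ultraP; have v2 := pull _ snd_ultraP.
have nuu : ~ ([set E | G [set t | fst_ultra t E]] = u /\
              [set E | G [set t | snd_ultra t E]] = u).
  move=> [e1 e2]; have : [set E | G [set t | fst_ultra t E]] C by rewrite e1.
  have : [set E | G [set t | snd_ultra t E]] C by rewrite e2.
  move=> /= G2 G1.
  by have [t [[t1 t2]]] := filter_ex (filterI (filterI G1 G2) GC); exact.
exists (PlankPoint v1 v2 nuu : plank); split=> /=.
  move=> [/= G1 G2].
  by have [t [[t1 t2]]] := filter_ex (filterI (filterI G1 G2) GC); exact.
move=> A; rewrite nbhsE => -[B [oB Bt] BA].
have [E [D [[/= GE GD] EDB]]] := oB _ Bt.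
apply: filterS (filterI GE GD) => t [t1 t2].
by apply: BA; apply: EDB.
Qed.

(** No point is the corner, so one coordinate differs from [u] infinitely often. By [ultra_avoid] a
    subsequence then stays outside some [box C C] with [C] in [u]. *)
Lemma plank_subsequence_compact : subsequence_compact plank.
Proof.
move=> x.
have [f1|nf1] := pselect (forall N, exists2 n, (N <= n)%N &
                            [set n | fst_ultra (x n) <> u] n).
  have [phi hphi phiu] := frequently_subsequence f1.
  have [psi [C [hpsi uC psiC]]] :=
    ultra_avoid uU (fun n => fst_ultraP (x (phi n))) phiu.
  exists (phi \o psi), (~` box C C); split; last by move=> n [/= /psiC].
    by move=> m n mn /=; exact/hphi/hpsi.
  exact: compact_setC_box.
have [|phi hphi phiu] := @frequently_subsequence [set n | snd_ultra (x n) <> u].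
  move=> N; apply: contrapT => nN; apply: nf1 => M.
  exists (maxn M N); first exact: leq_maxl.
  move=> xu1; apply: nN; exists (maxn M N); first exact: leq_maxr.
  by move=> xu2; exact: (@plank_neq (x (maxn M N)) (conj xu1 xu2)).
have [psi [C [hpsi uC psiC]]] :=
  ultra_avoid uU (fun n => snd_ultraP (x (phi n))) phiu.
exists (phi \o psi), (~` box C C); split; last by move=> n [/= _ /psiC].
  by move=> m n mn /=; exact/hphi/hpsi.
exact: compact_setC_box.
Qed.

Hypothesis u_free : forall N, u [set n | (N <= n)%N].

Lemma at_point_neq n : at_point n <> u.
Proof. by move=> nu; have := u_free n.+1; rewrite -nu /at_point /= ltnn. Qed.

Definition point_left (n : nat) (w : set_system nat) (wU : UltraFilter w) :
    plank :=
  PlankPoint (at_point_ultra n) wU (fun e => at_point_neq e.1).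

Definition point_right (v : set_system nat) (vU : UltraFilter v) (n : nat) :
    plank :=
  PlankPoint vU (at_point_ultra n) (fun e => at_point_neq e.2).

Definition grid (n m : nat) : plank := point_left n (at_point_ultra m).

Lemma plank_sequence_dense : exists d, @sequence_dense plank d.
Proof.
exists (fun k => if unpickle k is Some (n, m) then grid n m else grid 0 0).
move=> A oA [t At]; have [C [D [[tC tD] CDA]]] := oA t At.
have F1 := fst_ultraP t; have F2 := snd_ultraP t.
have [n Cn] := filter_ex tC; have [m Dm] := filter_ex tD.
by exists (pickle (n, m)); rewrite pickleK; exact: CDA.
Qed.

(* Choosing [z] with [g (z i, z j)] small and [g (z j, z i)] large for
   [i < j], both bounds pass to a limit point [(v, v)] of the diagonal. *)
Lemma edges_not_separated (R : realType) (g : plank -> R) (e : R) :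
  continuous g -> (0 < e)%R -> (forall t, top_edge t -> g t = 0%R) ->
  (forall t, right_edge t -> (e <= g t)%R) -> False.
Proof.
move=> /continuousP cg e0 gtop gright.
have olt (c : R) : open [set t | (g t < c)%R].
  by apply: (cg [set y | (y < c)%R]); exact: open_lt.
have ogt (c : R) : open [set t | (c < g t)%R].
  by apply: (cg [set y | (c < y)%R]); exact: open_gt.
pose a := (e / 3)%R; pose b := (e / 3 * 2)%R.
(* The point [(n, u)] is on the top edge, where [g] vanishes; the grid points [(n, m)] converge to
   it along [u]. The right edge is treated likewise. *)
have uD n : u [set m | (g (grid n m) < a)%R].
  have [|C [D [[/= nC uD] CDg]]] := olt a (point_left n uU).
    by rewrite /= gtop //; rewrite /a; lra.
  by apply: filterS uD => m Dm; apply: (CDg (grid n m)).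
have uC m : u [set n | (b < g (grid n m))%R].
  have [|C [D [[/= uC Dm] CDg]]] := ogt b (point_right uU m).
    by apply: lt_le_trans (gright _ _) => //; rewrite /b; lra.
  by apply: filterS uC => n Cn; apply: (CDg (grid n m)).
(* The admissible successors of [z]: both inequalities hold for [u]-almost all numbers. *)
pose DC z := [set m | (g (grid z m) < a)%R] `&` [set n | (b < g (grid n z))%R].
have nxt (s : {s : set nat * nat | u s.1}) : {s' : {s : set nat * nat | u s.1} |
    (sval s').1 `<=` (sval s).1 `&` DC (sval s).2 /\
    (sval s').1 (sval s').2}.
  case: s => -[E z] /= uE; apply: cid.
  have uE' : u (E `&` DC z) by apply: filterI => //; exact: filterI.
  have [z' Ez'] := filter_ex uE'.
  by exists (exist _ (E `&` DC z, z') uE'); split.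
have uT : u setT by exact: filterT.
have [s [_ sS]] := dependent_choice nxt (exist _ (setT, 0) uT).
pose E k := (sval (s k)).1; pose z k := (sval (s k.+1)).2.
have Edec i j : (i <= j)%N -> E j `<=` E i.
  elim: j => [|j IH]; first by rewrite leqn0 => /eqP ->.
  rewrite leq_eqVlt => /predU1P[->//|]; rewrite ltnS => /IH.
  by apply: subset_trans; have [+ _] := sS j => /subset_trans; apply => ? [].
have zDC i j : (i < j)%N -> DC (z i) (z j).
  move=> ij; have [sE _] := sS i.+1; have [_ zE] := sS j.
  by have [] := sE _ (@Edec i.+2 j.+1 ij _ zE).
(* The set [C] is in [u] but misses all [z (phi n)], so the image [v] of [u] differs from [u] and
   [(v, v)] is a point of the plank. *)
have [phi [C [hphi uC' nC]]] :=
  ultra_avoid uU (fun l => at_point_ultra (z l)) (fun l => @at_point_neq (z l)).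
pose v := [set A | u ((z \o phi) @^-1` A)].
have vU : UltraFilter v by exact: ultra_pullback.
have nvu : ~ (v = u /\ v = u).
  move=> [vu _]; have vC : v C by rewrite vu.
  by have [n] := @filter_ex _ u _ _ vC; exact: nC.
have uv A i : v A -> exists2 n, (i < n)%N & A (z (phi n)).
  move=> vA.
  have [n [An /= ltin]] := filter_ex (@filterI _ u _ _ _ vA (u_free i.+1)).
  by exists n.
pose t : plank := PlankPoint vU vU nvu.
have ga : (g t <= a)%R.
  rewrite leNgt; apply/negP => gt.
  have [A [B [[/= vA vB] ABg]]] := ogt a t gt.
  have [i _ Ai] := uv A 0%N vA; have [n ltin Bn] := uv B i vB.
  have : (a < g (grid (z (phi i)) (z (phi n))))%R by apply: ABg.
  by have [/= + _] := zDC _ _ (hphi _ _ ltin) => /lt_trans /[apply]; rewrite ltxx.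
have gb : (b <= g t)%R.
  rewrite leNgt; apply/negP => gt.
  have [A [B [[/= vA vB] ABg]]] := olt b t gt.
  have [i _ Bi] := uv B 0%N vB; have [n ltin An] := uv A i vA.
  have : (g (grid (z (phi n)) (z (phi i))) < b)%R by apply: ABg.
  by have [_ /= +] := zDC _ _ (hphi _ _ ltin) => /lt_trans /[apply]; rewrite ltxx.
by have := le_trans gb ga; rewrite /a /b; lra.
Qed.

End Plank.

Lemma nonseparated_space_exists :
  exists (T : topologicalType) (H L : set T),
    [/\ regular_space T, subsequence_compact T, exists d, @sequence_dense T d
      & [/\ closed H, closed L & H `&` L = set0]] /\
    forall (R : realType) (g : T -> R) (e : R), continuous g -> (0 < e)%R ->
      (forall t, H t -> g t = 0%R) -> (forall t, L t -> (e <= g t)%R) -> False.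
Proof.
have [u [uU ooU]] := ultraFilterLemma (F := \oo) _.
have uf N : u [set n | (N <= n)%N] by apply: ooU; exact: nbhs_infty_ge.
exists (plank u), (top_edge (u := u)), (right_edge (u := u)); split.
  split; [exact: plank_regular|exact: plank_subsequence_compact| |].
    exact: plank_sequence_dense.
  split; [exact: closed_top_edge|exact: closed_right_edge|].
  exact: edges_disjoint.
by move=> R g e cg e0; exact: edges_not_separated.
Qed.

(** * Jones' machine *)

Section Jones.
Variables (T : topologicalType) (H L : set T).
Hypotheses (cH : closed H) (cL : closed L) (HL : H `&` L = set0).

Local Open Scope ring_scope.

(** The seam between the copies [n] and [n + 1]. *)
Definition glue (n : int) : set T := if odd (absz n) then L else H.

Lemma closed_glue n : closed (glue n).
Proof. by rewrite /glue; case: ifP. Qed.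

Lemma glue_even (a : int) : glue (a * 2) = H.
Proof. by rewrite /glue; have -> : odd (absz (a * 2)%R) = false by lia. Qed.

Lemma glue_odd (a : int) : glue (a * 2 - 1) = L.
Proof. by rewrite /glue; have -> : odd (absz (a * 2 - 1)%R) = true by lia. Qed.

Lemma glue_disjoint n t : glue n t -> glue (n + 1) t -> False.
Proof.
have HLt : ~ (H `&` L) t by rewrite HL.
rewrite /glue; have -> : odd (absz (n + 1)%R) = ~~ odd (absz n) by lia.
by case: odd => /= ? ?; apply: HLt.
Qed.

(* The copies [n] and [i] of [t] are glued together. *)
Definition chain_adj (t : T) (n i : int) : Prop :=
  [\/ i = n, i = n + 1 /\ glue n t | n = i + 1 /\ glue i t].

Lemma chain_adj_sym t n i : chain_adj t n i -> chain_adj t i n.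
Proof. by case=> [->|?|?]; [apply: Or31|apply: Or33|apply: Or32]. Qed.

(** As [H] and [L] are disjoint, a point is glued to at most one other copy, so two steps reduce to
    one. The first hypothesis lets [t'] be a point near [t] rather than [t] itself. *)
Lemma chain_adj_trans t t' n i j : (forall k, glue k t' -> glue k t) ->
  chain_adj t n i -> chain_adj t' i j -> chain_adj t n j.
Proof.
move=> tt' [->|[-> gn]|[ni gi]] [->|[-> /tt' g]|[ji /tt' g]].
- exact: Or31.
- exact: Or32.
- exact: Or33.
- exact: Or32.
- by exfalso; exact: glue_disjoint gn g.
- by apply: Or31; apply: (addIr 1).
- exact: Or33.
- exact: Or31.
- by exfalso; rewrite ji in gi; exact: glue_disjoint g gi.
Qed.

(** A set must be a neighbourhood in every copy glued to the point; this encodes the quotient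
    without identifying points. The ends see whole tails of copies. *)
Definition jones_nbhs (s : T * int + bool) : set_system (T * int + bool) :=
  match s with
  | inl (t, n) => [set A | forall i, chain_adj t n i ->
                                nbhs t [set t' | A (inl (t', i))]]
  | inr b => [set A | A (inr b) /\ exists N : int, forall t n,
                (if b then N <= n else n <= N) -> A (inl (t, n))]
  end.

Lemma jones_filter s : Filter (jones_nbhs s).
Proof.
case: s => [[t n]|b] /=.
  split=> [i _|A B nA nB i ti|A B AB nA i ti]; first exact: filterT.
    by apply: filterS (filterI (nA i ti) (nB i ti)).
  by apply: filterS (nA i ti) => t'; exact: AB.
split=> [|A B [Ab [N AN]] [Bb [M BM]]|A B AB [Ab [N AN]]].
- by split=> //; exists 0.
- split=> //; exists (if b then N + `|M| + `|N| else N - `|M| - `|N|) => t n bn.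
  by split; [apply/AN|apply/BM]; case: b bn {Ab Bb AN BM}; lia.
- by split; [exact: AB|exists N => t n /AN /AB].
Qed.

Definition jones := from_nbhs jones_filter.

Definition jones_pt (n : int) (t : T) : jones := inl (t, n).
Definition jones_end (b : bool) : jones := inr b.

Lemma jones_pt_continuous n : continuous (jones_pt n).
Proof.
apply/continuousP => A; rewrite from_nbhs_openE => oA.
by rewrite openE => t At; apply: (oA _ At); exact: Or31.
Qed.

(** With [above], the two open sides of the seam between copies [m] and [m + 1]; the seam belongs to
    neither. *)
Definition below (m : int) : set jones := [set s | match s : T * int + bool with
  | inl (t, n) => n <= m /\ (n = m -> ~ glue m t) | inr b => ~~ b end].

Definition above (m : int) : set jones := [set s | match s : T * int + bool with
  | inl (t, n) => m < n /\ (n = m + 1 -> ~ glue m t) | inr b => b end].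

Lemma nbhs_notin_glue t m (P : Prop) : (P -> ~ glue m t) ->
  nbhs t [set t' | P -> ~ glue m t'].
Proof.
have [p|np] := pselect P; last by move=> _; apply: filterE => t' /np.
move=> /(_ p) nt; have : nbhs t (~` glue m).
  by apply: open_nbhs_nbhs; split=> //; apply: closed_openC; exact: closed_glue.
by apply: filterS => t' ? _.
Qed.

Lemma open_below m : open (below m).
Proof.
rewrite from_nbhs_openE => -[[t n] [nm gm] i tni|b /= nb].
  have im : i <= m.
    case: tni => [->//|[-> g]|[ni g]]; last by lia.
    have [nm'|] := eqVneq n m; last by lia.
    by exfalso; apply: (gm nm'); rewrite -nm'.
  have gi : i = m -> ~ glue m t.
    case: tni => [->//|[-> g]|[ni g]]; last by lia.
    by move=> <- g'; exact: glue_disjoint g g'.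
  by apply: filterS (nbhs_notin_glue gi) => t' ?; split.
split=> //; exists (m - 1) => t k; rewrite (negbTE nb) => km.
by split; [lia|move=> kE; lia].
Qed.

Lemma open_above m : open (above m).
Proof.
rewrite from_nbhs_openE => -[[t n] [nm gm] i tni|b /= nb].
  have im : m < i.
    case: tni => [->//|[-> g]|[ni g]]; first by lia.
    have [nm1|] := eqVneq n (m + 1); last by lia.
    have im : i = m by lia.
    by rewrite im in g; have := gm nm1.
  have gi : i = m + 1 -> ~ glue m t.
    case: tni => [->//|[-> g]|[ni g]]; first by lia.
    by move=> im1 g'; rewrite im1 in g; exact: glue_disjoint g' g.
  by apply: filterS (nbhs_notin_glue gi) => t' ?; split.
split=> //; exists (m + 2) => t k; rewrite nb => km.
by split; [lia|move=> kE; lia].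
Qed.

Lemma below_above m : below m `<=` ~` above m.
Proof. by move=> [[t n]|[]] //= [nm _] [mn _]; lia. Qed.

Lemma jones_regular : regular_space T -> regular_space jones.
Proof.
move=> regT; apply/regular_spaceP => s A oA As.
have := oA; rewrite from_nbhs_openE => /(_ s As).
case: s As => [[t n] /=|[]] As /=.
(* Near [t] a point is on [H] or [L] only if [t] is, so gluings at such points are gluings at [t].
   Hence the union [star C] of [C] over the copies glued at [t] is closed. *)
- move=> An; pose V := [set t' | (H t' -> H t) /\ (L t' -> L t)] `&`
    [set t' | forall i, chain_adj t n i -> A (inl (t', i))].
  have tV : nbhs t V.
    apply: filterI; last first.
      have Ai (i : int) : nbhs t [set t' | chain_adj t n i -> A (inl (t', i))].
        have [tni|ntni] := pselect (chain_adj t n i); last first.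
          by apply: filterE => t' /ntni.
        by apply: filterS (An i tni) => t' ? _.
      apply: filterS (filterI (Ai n) (filterI (Ai (n + 1)) (Ai (n - 1)))).
      move=> t' [A0 [A1 A2]] i tni; have [in0|[in1 _]|[in2 _]] := tni.
      + by rewrite in0 in tni *; exact: A0.
      + by rewrite in1 in tni *; exact: A1.
      + have iE : i = n - 1 by rewrite in2 addrK.
        by rewrite iE in tni *; exact: A2.
    have nF (F : set T) : closed F -> nbhs t [set t' | F t' -> F t].
      move=> cF; have [Ft|nFt] := pselect (F t); first by apply: filterE => t' _.
      have : nbhs t (~` F) := open_nbhs_nbhs (conj (closed_openC cF) nFt).
      by apply: filterS => t' ? ?.
    by apply: filterS (filterI (nF H cH) (nF L cL)) => t' [].
  have [C cC [tC CV]] := regular_nbhs regT tV.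
  have Cglue t' k : C t' -> glue k t' -> glue k t.
    by move=> /CV[[tH tL] _]; rewrite /glue; case: ifP.
  pose star (B : set T) : set jones := [set s | match s : T * int + bool with
    | inl (t', i) => chain_adj t n i /\ B t' | inr b => False end].
  exists (star C°), (star C); split.
  + rewrite from_nbhs_openE => -[[t' i] [tni Ct'] j t'ij|b []//].
    have tnj : chain_adj t n j.
      exact: (chain_adj_trans (fun k => Cglue t' k (interior_subset Ct')) tni).
    by apply: filterS (open_nbhs_nbhs (conj (@open_interior _ C) Ct')) => t''; split.
  + by split; [exact: Or31|].
  + by move=> [[t' i] [? ?]|//]; split=> //; exact: interior_subset.
  + rewrite -openC from_nbhs_openE => -[[t' i] nC j t'ij|b _].
      have [tnj|ntnj] := pselect (chain_adj t n j); last first.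
        by apply: filterE => t'' [].
      have nCt' : ~ C t'.
        move=> Ct'; apply: nC; split=> //.
        have := chain_adj_sym t'ij.
        exact: (chain_adj_trans (fun k => Cglue t' k Ct') tnj).
      have : nbhs t' (~` C) := open_nbhs_nbhs (conj (closed_openC cC) nCt').
      by apply: filterS => t'' nC'' [].
    split=> //; exists (if b then n + 2 else n - 2) => t' k bk [tnk _].
    by case: tnk b bk => [->|[-> _]|[ni _]] [] ?; lia.
  + by move=> [[t' i] [tni /CV[_]]|//]; exact.
(* The seam after copy [N] cuts off the right end: what is outside [below N] lies in copies from [N]
   on. *)
- move=> [_ [N AN]]; exists (above N), (~` below N); split=> //.
  + exact: open_above.
  + by move=> x xa xb; exact: below_above xa.
  + exact/open_closedC/open_below.
  + move=> [[t n] nb|[]//]; last by move=> /(_ isT).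
    apply: AN; rewrite leNgt; apply/negP => nN.
    by apply: nb; split; [exact: ltW|lia].
(* The cut is at [N - 1] because the complement of [above (N - 1)] reaches copy [N] along the
   seam. *)
- move=> [_ [N AN]]; exists (below (N - 1)), (~` above (N - 1)); split=> //.
  + exact: open_below.
  + exact: below_above.
  + exact/open_closedC/open_above.
  + move=> [[t n] na|[]//]; last by move=> /(_ isT).
    apply: AN; rewrite leNgt; apply/negP => nN.
    by apply: na; split; lia.
Qed.

Lemma closed_jones_end b : closed [set jones_end b].
Proof.
rewrite -openC from_nbhs_openE => -[[t n] _ i _|b' /= nb].
  by apply: filterE => t' e; discriminate e.
by split=> //; exists 0 => t n _ e; discriminate e.
Qed.

Lemma jones_ends_neq : jones_end false <> jones_end true.
Proof. by move=> e; discriminate e. Qed.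

Lemma jones_sequence_dense :
  (exists d, @sequence_dense T d) -> exists d, @sequence_dense jones d.
Proof.
move=> [d dd]; exists (fun k => match unpickle k : option (nat * int + bool) with
  | Some (inl (k, n)) => jones_pt n (d k) | Some (inr b) => jones_end b
  | None => jones_end true end).
move=> A oA [[[t n]|b] As].
  have [|k Ak] := dd (jones_pt n @^-1` A) _ (ex_intro _ t As).
    by have /continuousP := @jones_pt_continuous n; exact.
  by exists (pickle (inl (k, n) : nat * int + bool)); rewrite pickleK.
by exists (pickle (inr b : nat * int + bool)); rewrite pickleK.
Qed.

Lemma jones_glue_eq (R : realType) (f : jones -> R) n t : continuous f ->
  glue n t -> f (jones_pt n t) = f (jones_pt (n + 1) t).
Proof.
move=> cf gt; apply: continuous_indistinguishable cf _ => A.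
rewrite from_nbhs_openE => oA /oA /(_ (n + 1)) /(_ (Or32 _ _ (conj erefl gt))).
exact: nbhs_singleton.
Qed.

(** The alternating sum [h M] vanishes termwise on [H]; on [L] it telescopes to a difference of
    values close to those at the two ends. So its absolute value would separate [H] from [L]. *)
Lemma jones_ends_eq (R : realType) (f : jones -> R) :
  (forall (g : T -> R) e, continuous g -> 0 < e -> (forall t, H t -> g t = 0) ->
    (forall t, L t -> e <= g t) -> False) ->
  continuous f -> f (jones_end false) = f (jones_end true).
Proof.
move=> nsep cf; apply: contrapT => /eqP; rewrite -subr_eq0 -normr_gt0.
set c := _ - _ => c0; pose e := `|c| / 2.
have e0 : 0 < e by rewrite divr_gt0.
have e20 : 0 < e / 2 by rewrite divr_gt0.
have tail b : exists N : int, forall t n, (if b then N <= n else n <= N) ->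
    `|f (jones_end b) - f (jones_pt n t)| < e / 2.
  have : open (f @^-1` ball (f (jones_end b)) (e / 2)).
    by move/continuousP: cf; apply; exact: ball_open.
  rewrite from_nbhs_openE => /(_ (jones_end b)) [].
    exact: ballxx.
  by move=> _ [N NA]; exists N => t n bn; exact: (NA t n bn).
have [N0 fN0] := tail false; have [N1 fN1] := tail true.
pose g n t := f (jones_pt n t).
have cg n : continuous (g n).
  by move=> t; apply: continuous_comp; [exact: jones_pt_continuous|exact: cf].
have gE n t : glue n t -> g n t = g (n + 1) t by exact: jones_glue_eq.
(* Chosen so that copy [a * 2 - 1] is in the left tail. *)
pose a : int := - (absz N0)%:Z.
pose h (M : nat) t :=
  \sum_(i < M) (g ((a + i%:Z) * 2) t - g ((a + i%:Z) * 2 + 1) t).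
have hH M t : H t -> h M t = 0.
  by move=> Ht; apply: big1 => i _; rewrite gE ?subrr // glue_even.
have hL M t : L t -> h M t = g (a * 2 - 1) t - g ((a + M%:Z) * 2 - 1) t.
  move=> Lt; elim: M => [|M IH]; first by rewrite /h big_ord0 addr0 subrr.
  rewrite /h big_ord_recr /= -/(h M t) IH.
  rewrite (gE ((a + M%:Z) * 2 - 1)); last by rewrite glue_odd.
  have -> : (a + M%:Z) * 2 - 1 + 1 = (a + M%:Z) * 2 by lia.
  have -> : (a + M.+1%:Z) * 2 - 1 = (a + M%:Z) * 2 + 1 by lia.
  by rewrite subrKA.
have ch M : continuous (h M).
  elim: M => [|M IH] t.
    rewrite (_ : h 0%N = fun=> 0); first exact: cvg_cst.
    by apply/funext => t'; rewrite /h big_ord0.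
  rewrite (_ : h M.+1 = fun t =>
      h M t + (g ((a + M%:Z) * 2) t - g ((a + M%:Z) * 2 + 1) t)).
    by apply: cvgD; [exact: IH|apply: cvgB; exact: cg].
  by apply/funext => t'; rewrite /h big_ord_recr.
(* Then [(a + M) * 2 - 1] is [2 * |N1| + 1], in the right tail. *)
pose M := (absz N0 + absz N1 + 1)%N.
apply: (nsep (fun t => `|h M t|) e).
- by move=> t; apply: cvg_norm; exact: ch.
- exact: e0.
- by move=> t /hH ->; rewrite normr0.
- move=> t /hL ->.
  have := fN0 t (a * 2 - 1); have := fN1 t ((a + M%:Z) * 2 - 1).
  rewrite -!/(g _ _) => /(_ _) h1 /(_ _) h0.
  have {}h1 := h1 ltac:(rewrite /a /M; lia).
  have {}h0 := h0 ltac:(rewrite /a; lia).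
  move: h0 h1; rewrite /e /c.
  set x := f _; set y := f _; set z := g _ _; set w := g _ _.
  have := ler_normD (x - z) (z - w); have := ler_normD (x - z + (z - w)) (w - y).
  rewrite (distrC w y) (_ : x - z + (z - w) + (w - y) = x - y); last by ring.
  by lra.
Qed.

Lemma convergent_compact (S : topologicalType) (y : nat -> S) (z : S) :
  y @ \oo --> z -> compact (z |` range y).
Proof.
move=> yz; rewrite compact_ultra => G GU Gy.
have [Gz|nGz] := pselect (G --> z); first by exists z; split=> //; left.
have [A [zA nGA]] : exists A, nbhs z A /\ ~ G A.
  apply: contrapT => nA; apply: nGz => A zA; apply: contrapT => nGA.
  by apply: nA; exists A.
have [N _ NA] := yz _ zA.
have : G (y @` `I_N).
  apply: filterS (filterI Gy (ultra_setC GU nGA)) => s [[->|[n _ <-]] nAs].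
    by exfalso; exact: (nAs (nbhs_singleton zA)).
  exists n => //=; rewrite ltnNge; apply/negP => Nn; apply: nAs.
  exact: (NA n Nn).
have := finite_compact (finite_image y (finite_II N)).
rewrite compact_ultra => /[apply] -[s [[n _ <-] Gs]].
by exists (y n); split=> //; right; exists n.
Qed.

(** Either one copy is visited infinitely often, and [T] gives the compact set, or the sequence
    leaves every finite union of copies and a subsequence converges to an end. *)
Lemma jones_subsequence_compact :
  subsequence_compact T -> subsequence_compact jones.
Proof.
move=> sT x.
pose copy (n : int) : set jones := range (jones_pt n).
have [[n nf]|nfr] :=
  pselect (exists n, forall N, exists2 l, (N <= l)%N & copy n (x l)).
  have [phi hphi phix] := @frequently_subsequence [set l | copy n (x l)] nf.
  have xt l : exists t, jones_pt n t = x (phi l) by have [t _] := phix l; exists t.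
  have [t xtE] := choice xt.
  have [psi [K [hpsi cK Kt]]] := sT t.
  exists (phi \o psi), (jones_pt n @` K); split.
  - by move=> i j ij /=; exact/hphi/hpsi.
  - apply: continuous_compact => //; apply: continuous_subspaceT.
    exact: jones_pt_continuous.
  - by move=> l; exists (t (psi l)) => //; exact: xtE.
have ev (M : nat) : exists N, forall l n t, (N <= l)%N -> x l = jones_pt n t ->
    (M <= absz n)%N.
  elim: M => [|M [N NM]]; first by exists 0%N.
  have avoid n : exists N, forall l t, (N <= l)%N -> x l <> jones_pt n t.
    apply: contrapT => nN; apply: nfr; exists n => N'.
    apply: contrapT => nl; apply: nN; exists N' => l t Nl xlt; apply: nl.
    by exists l => //; exists t.
  have [N1 xN1] := avoid M%:Z; have [N2 xN2] := avoid (- M%:Z).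
  exists (maxn N (maxn N1 N2)) => l n t; rewrite !geq_max => /and3P[l0 l1 l2] xl.
  have nM := NM _ _ _ l0 xl.
  have n1 : n <> M%:Z by move=> e; apply: (xN1 l t l1); rewrite xl e.
  have n2 : n <> - M%:Z by move=> e; apply: (xN2 l t l2); rewrite xl e.
  by lia.
pose side (s : jones) : bool :=
  match s : T * int + bool with inl (_, n) => 0 <= n | inr b => b end.
have [b fb] : exists b, forall N, exists2 l, (N <= l)%N &
    [set l | side (x l) = b] l.
  have [ft|nft] := pselect (forall N, exists2 l, (N <= l)%N &
                              [set l | side (x l) = true] l).
    by exists true.
  exists false => N; apply: contrapT => nl; apply: nft => N'.
  exists (maxn N N'); first exact: leq_maxr.
  apply: contrapT => /negP/negbTE xf; apply: nl; exists (maxn N N') => //.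
  exact: leq_maxl.
have [phi hphi phib] := frequently_subsequence fb.
exists phi, (jones_end b |` range (x \o phi)); split=> //; last first.
  by move=> n; right; exists n.
apply: convergent_compact => A; rewrite nbhsE => -[B [oB Bb] BA].
have := oB; rewrite from_nbhs_openE => /(_ _ Bb) /= -[_ [M MB]].
have [N NM] := ev (absz M).+1.
exists N => // l Nl /=; apply: BA.
have := phib l; rewrite /= /side; case xl : (x (phi l)) => [[t n]|b'] e.
  apply/MB; have := NM (phi l) n t (leq_trans Nl (homo_ltn_id_le hphi l)) xl.
  by case: b e {fb phib Bb MB} => e; lia.
by rewrite e.
Qed.

End Jones.

(** * The rigid space of words *)

Section Words.
Variables (J : topologicalType) (p q : J).
Hypotheses (cp : closed [set p]) (cq : closed [set q]) (npq : p <> q).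

Local Open Scope nat_scope.

(** The [k]-th letter of [w] is forgotten; [k.+1] is the last place with a letter other than [p]. *)
Definition level (k : nat) (w : nat -> J) : Prop :=
  w k.+1 = q /\ forall j, k.+1 < j -> w j = p.

Lemma level_uniq k l w : level k w -> level l w -> k = l.
Proof.
have lt_false i j : level i w -> level j w -> i < j -> False.
  by move=> [_ wp] [wq _] ij; apply: npq; rewrite -wq wp.
by move=> kw lw; have [/(lt_false _ _ kw lw)|/(lt_false _ _ lw kw)|] := ltngtP k l.
Qed.

(* A forgotten letter is left free; this is coarser than the quotient topology
   of the product, whose regularity would require a tube lemma. *)
Definition words_nbhs (w : nat -> J) : set_system (nat -> J) :=
  [set A | exists m (V : nat -> set J), (forall i, nbhs (w i) (V i)) /\
     forall w', (forall i, i < m -> ~ level i w -> V i (w' i)) -> A w'].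

Lemma words_filter w : Filter (words_nbhs w).
Proof.
split=> [|A B [m [V [wV VA]]] [n [W [wW WB]]]|A B AB [m [V [wV VA]]]].
- by exists 0, (fun=> setT); split=> // i; exact: filterT.
- exists (maxn m n), (fun i => V i `&` W i); split=> [i|w' w'VW].
    exact: filterI.
  split; [apply: VA|apply: WB] => i im iw.
    by have [] := w'VW i (leq_trans im (leq_maxl _ _)) iw.
  by have [] := w'VW i (leq_trans im (leq_maxr _ _)) iw.
- by exists m, V; split=> // w' /VA /AB.
Qed.

Definition words := from_nbhs words_filter.

Lemma words_nbhs_coord i (w : nat -> J) V : ~ level i w -> nbhs (w i) V ->
  words_nbhs w [set w' | V (w' i)].
Proof.
move=> iw wV; exists i.+1, (fun j => if j == i then V else setT); split.
  by move=> j; case: eqP => [->//|_]; exact: filterT.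
by move=> w' /(_ i (ltnSn i) iw); rewrite eqxx.
Qed.

Lemma nbhs_neq (a x : J) : closed [set a] -> x <> a -> nbhs x [set~ a].
Proof.
by move=> /closed_openC oa xa; apply: open_nbhs_nbhs.
Qed.

(** One letter, by not being [q] or not being [p], witnesses that [level l] fails, and this is an
    open condition. The cases find a witness that is not itself forgotten in [w]. *)
Lemma words_nbhs_not_level l (w : nat -> J) : ~ level l w ->
  words_nbhs w [set w' | ~ level l w'].
Proof.
move=> lw; have FN := words_filter w.
have away_q : ~ level l.+1 w -> w l.+1 <> q -> words_nbhs w [set w' | ~ level l w'].
  move=> l1w wq; apply: filterS (words_nbhs_coord l1w (nbhs_neq cq wq)).
  by move=> w' /= w'q [].
have away_p j : l.+1 < j -> ~ level j w -> w j <> p ->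
    words_nbhs w [set w' | ~ level l w'].
  move=> lj jw wp; apply: filterS (words_nbhs_coord jw (nbhs_neq cp wp)).
  by move=> w' /= w'p [_ /(_ j lj)].
have [[k kw]|nk] := pselect (exists k, level k w); last first.
  have nlw j : ~ level j w by move=> jw; apply: nk; exists j.
  have [wq|] := pselect (w l.+1 = q); last exact: away_q.
  have [j jP] : exists j, ~ (l.+1 < j -> w j = p).
    apply: contrapT => nj; apply: lw; split=> // j lj; apply: contrapT => wp.
    by apply: nj; exists j => /(_ lj).
  have lj : l.+1 < j by apply: contrapT => lj; apply: jP => /lj.
  by apply: (away_p j) => // wp; apply: jP.
have nkw j : j <> k -> ~ level j w by move=> jk jw; apply: jk; exact: level_uniq kw.
case: (kw) => wq wp.
have [kl|lk|kl] := ltngtP k l; last by rewrite kl in kw.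
- apply: away_q; first by apply: nkw; lia.
  by rewrite wp.
- apply: (away_p k.+1) => //; first by apply: nkw; lia.
  by rewrite wq; exact/nesym.
Qed.

Definition update (w : nat -> J) k (x : J) : nat -> J :=
  fun i => if i == k then x else w i.

Lemma level_update w k x : level k w -> level k (update w k x).
Proof.
move=> [wq wp]; split; rewrite /update; first by rewrite gtn_eqF.
by move=> j kj; rewrite gtn_eqF ?wp // ltnW.
Qed.

Lemma level_open_update k (w : words) x (A : set words) :
  level k w -> open A -> A w -> A (update w k x).
Proof.
move=> kw; rewrite from_nbhs_openE => oA /oA[m [V [wV VA]]]; apply: VA => i im iw.
rewrite /update; case: eqP => [ik|_]; last exact: nbhs_singleton.
by rewrite ik in iw.
Qed.

Lemma words_regular : regular_space J -> regular_space words.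
Proof.
move=> regJ; apply/regular_spaceP => w A oA Aw.
have := oA; rewrite from_nbhs_openE => /(_ w Aw) [m [V [wV VA]]].
have CV i : exists C, [/\ closed C, nbhs (w i) C & C `<=` V i].
  by have [C cC [wC CVi]] := regular_nbhs regJ (wV i); exists C.
have {CV} [C CP] := choice CV.
(* A letter is controlled only where it is not forgotten. So [U] also keeps the letters remembered
   in [w] remembered, which makes it open, while [F] exempts letters forgotten in either word. *)
pose U : set words := [set w' |
  (forall i, i < m -> ~ level i w -> (C i)° (w' i)) /\
  (forall i, i < m -> ~ level i w -> ~ level i w')].
pose F : set words := [set w' |
  forall i, i < m -> ~ level i w -> ~ level i w' -> C i (w' i)].
exists U, F; split.
- rewrite from_nbhs_openE => w' [Cw' lw']; have FN := words_filter w'.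
  apply: filterI; apply: filter_forall_ltn => i im.
    have [iw|niw] := pselect (level i w); first by apply: filterE.
    have wC := open_nbhs_nbhs (conj (@open_interior _ (C i)) (Cw' i im niw)).
    by apply: filterS (words_nbhs_coord (lw' i im niw) wC) => w'' ? _.
  have [iw|niw] := pselect (level i w); first by apply: filterE.
  by apply: filterS (words_nbhs_not_level (lw' i im niw)) => w'' ? _.
- by split=> [i im iw|//]; have [_ + _] := CP i.
- by move=> w' [Cw' _] i im iw iw'; exact: (interior_subset (Cw' i im iw)).
- rewrite -openC from_nbhs_openE => w' nFw'; have FN := words_filter w'.
  have [i [im iw iw' nC]] : exists i,
      [/\ i < m, ~ level i w, ~ level i w' & ~ C i (w' i)].
    apply: contrapT => ni; apply: nFw' => i im iw iw'.
    by apply: contrapT => nC; apply: ni; exists i.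
  have [cC _ _] := CP i.
  have wC : nbhs (w' i) (~` C i) := open_nbhs_nbhs (conj (closed_openC cC) nC).
  apply: filterS (filterI (words_nbhs_coord iw' wC) (words_nbhs_not_level iw')).
  by move=> w'' [/= nCw'' iw''] /(_ i im iw iw'').
- move=> w' Fw'; have [[k kw']|nk] := pselect (exists k, level k w').
    (* [F] says nothing about the forgotten letter of [w']. Replace it by that of [w] to enter [A],
       then restore it: [A] is open and cannot tell. *)
    have Aw'' : A (update w' k (w k)).
      apply: VA => i im iw; rewrite /update; case: eqP => [->|ik].
        by apply: nbhs_singleton; exact: wV.
      have [_ _ CVi] := CP i; apply: CVi; apply: Fw' => // iw'.
      by apply: ik; exact: level_uniq iw' kw'.
    have -> : w' = update (update w' k (w k)) k (w' k).
      by apply/funext => i; rewrite /update; case: eqP => [->|].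
    by apply: level_open_update => //; exact: level_update.
  apply: VA => i im iw; have [_ _ CVi] := CP i; apply: CVi; apply: Fw' => // iw'.
  by apply: nk; exists i.
Qed.

Definition base_word (x : J) : words := fun=> x.

Lemma closed_base_word : closed [set base_word p].
Proof.
rewrite -openC from_nbhs_openE => w wp; have FN := words_filter w.
have [i [iw wip]] : exists i, ~ level i w /\ w i <> p.
  have [[k [wq wp']]|nk] := pselect (exists k, level k w).
    exists k.+1; rewrite wq; split; last exact/nesym.
    by move=> kw; have := level_uniq (conj wq wp') kw; lia.
  apply: contrapT => ni; apply: wp; apply/funext => i; apply: contrapT => wip.
  by apply: ni; exists i; split=> // iw; apply: nk; exists i.
apply: filterS (words_nbhs_coord iw (nbhs_neq cp wip)) => w' /= + e.
by rewrite e.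
Qed.

Lemma base_word_neq : base_word q <> base_word p.
Proof. by move=> /(congr1 (fun w => w 0)) /= /esym. Qed.

Lemma update_continuous (w : nat -> J) k : continuous (update w k : J -> words).
Proof.
apply/continuousP => A; rewrite from_nbhs_openE openE => oA x Ax.
have [m [V [wV VA]]] := oA _ Ax.
have := wV k; rewrite /update eqxx => xV; apply: filterS xV => y Vy.
apply: VA => i im _; have := wV i; rewrite /update.
by case: eqP => [->|_] // /nbhs_singleton.
Qed.

Lemma words_rigid (R : realType) :
  (forall g : J -> R, continuous g -> g p = g q) -> rigid_space R words.
Proof.
move=> gpq f cf; exists (f (base_word p)).
have fpq w k : f (update w k p) = f (update w k q).
  have cfw : continuous (f \o (update w k : J -> words)).
    by move=> x; apply: continuous_comp; [exact: update_continuous|exact: cf].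
  exact: gpq cfw.
have fin k w : (forall j, k <= j -> w j = p) -> f w = f (base_word p).
  elim: k w => [|k IH] w wp.
    by congr f; apply/funext => j; exact: wp.
  have wE : w = update w k.+1 p.
    by apply/funext => j; rewrite /update; case: eqP => // ->; rewrite wp.
  have kw : level k (update w k.+1 q).
    split; rewrite /update ?eqxx // => j kj.
    by rewrite gtn_eqF ?wp // ltnW.
  (* Letter [k.+1] becomes [q], which forgets letter [k]; that letter becomes [p]; then letter
     [k.+1] returns to [p]. Only the first [k] letters remain free. *)
  rewrite wE fpq.
  have -> : f (update w k.+1 q) = f (update (update w k.+1 q) k p).
    by apply: continuous_indistinguishable cf _ => A oA; exact: level_open_update.
  have -> : update (update w k.+1 q) k p = update (update w k p) k.+1 q.
    apply/funext => j; rewrite /update.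
    by case: eqP => // ->; rewrite ltn_eqF.
  rewrite -fpq; apply: IH => j kj; rewrite /update.
  case: eqP => // /eqP jk1; case: eqP => // /eqP jk; apply: wp.
  by rewrite ltn_neqAle eq_sym jk.
move=> w; apply: contrapT => fw.
have : open (f @^-1` [set~ f (base_word p)]).
  move/continuousP: cf; apply; apply: closed_openC.
  exact/accessible_closed_set1/hausdorff_accessible/Rhausdorff.
rewrite from_nbhs_openE => /(_ w fw) [m [V [wV VA]]].
(* Neighbourhoods restrict finitely many letters, so a word that is eventually [p] would also miss
   the base value. *)
pose w' : words := fun i => if i < m then w i else p.
have : (f @^-1` [set~ f (base_word p)]) w'.
  by apply: VA => i im _; rewrite /w' im; exact: nbhs_singleton.
by apply; apply: (fin m) => j; rewrite /w' ltnNge => ->.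
Qed.

Lemma words_sequence_dense :
  (exists d, @sequence_dense J d) -> exists d, @sequence_dense words d.
Proof.
move=> [d dd].
exists (fun k i => let s : seq nat := odflt [::] (unpickle k) in
           if i < size s then d (nth 0 s i) else p).
move=> A + [w Aw]; rewrite from_nbhs_openE => /(_ w Aw) [m [V [wV VA]]].
have Vd i : exists n, V i (d n).
  have [|n Vn] := dd (V i)° (open_interior _); first by exists (w i); exact: wV.
  by exists n; exact: interior_subset.
have [n Vn] := choice Vd.
exists (pickle (mkseq n m)); apply: VA => i im _.
by rewrite pickleK /= size_mkseq im nth_mkseq.
Qed.

(** A diagonal subsequence is caught in a product of compact sets, compact by Tychonoff. *)
Lemma words_subsequence_compact :
  subsequence_compact J -> subsequence_compact words.
Proof.
move=> sJ x.
have ref (s : nat * (nat -> nat)) : exists s' : (nat -> nat) * set J,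
    [/\ {homo s'.1 : m n / m < n}, compact s'.2 &
        forall n, s'.2 (x (s.2 (s'.1 n)) s.1)].
  by have [psi [K psiK]] := sJ (fun n => x (s.2 n) s.1); exists (psi, K).
have {ref} [ref refP] := choice ref.
(* [Phi i] is the subsequence after the coordinates below [i] have been treated. *)
pose Phi := fix Phi i := if i is i'.+1 then Phi i' \o (ref (i', Phi i')).1 else id.
pose K i := (ref (i, Phi i)).2.
have PhiS i n : Phi i.+1 n = Phi i ((ref (i, Phi i)).1 n) by [].
have hPhi i : {homo Phi i : m n / m < n}.
  elim: i => // i IH m n mn; rewrite !PhiS; apply: IH.
  by have [+ _ _] := refP (i, Phi i); apply.
pose delta n := Phi n n.
have hdelta : {homo delta : m n / m < n}.
  apply: homo_ltn => [|n]; first exact: ltn_trans.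
  rewrite /delta PhiS; apply: hPhi.
  by have [+ _ _] := refP (n, Phi n) => /homo_ltn_id_le; exact.
have Phi_range i n l : i <= n -> exists l', Phi n l = Phi i l'.
  elim: n l => [|n IH] l; first by rewrite leqn0 => /eqP ->; exists l.
  rewrite leq_eqVlt => /predU1P[->|]; first by exists l.
  by rewrite ltnS => /(IH ((ref (n, Phi n)).1 l)).
have Kdelta i n : i < n -> K i (x (delta n) i).
  move=> /(Phi_range _ _ n) [l' l'E]; rewrite /delta l'E PhiS.
  by have [_ _ +] := refP (i, Phi i); exact.
(* The diagonal is sure to be in [K i] only from index [i.+1] on; the earlier values are added by
   hand. *)
pose K' i := K i `|` (fun n => x (delta n) i) @` `I_i.+1.
have cK' i : compact (K' i).
  apply: compactU; first by have [] := refP (i, Phi i).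
  exact/finite_compact/finite_image/finite_II.
(* The topology of words is coarser than the product topology, so compact sets carry over. *)
pose P : topologicalType := prod_topology (fun _ : nat => J).
have cid : continuous (id : P -> words).
  apply/continuousP => A; rewrite from_nbhs_openE openE => oA w Aw.
  have [m [V [wV VA]]] := oA _ Aw.
  have FP : Filter (@nbhs P P w) by apply: filter_filter.
  apply: filterS (filter_forall_ltn (m := m) FP (fun i _ => proj_continuous (wV i))).
  by move=> w' w'V; apply: VA => i im _; exact: w'V.
exists delta, ((id : P -> words) @` [set w : P | forall i, K' i (w i)]).
split=> //; last first.
  move=> n; exists (x (delta n)) => // i.
  by have [/Kdelta|ni] := ltnP i n; [left|right; exists n].
apply: continuous_compact (@tychonoff _ (fun=> J) _ cK').
exact: continuous_subspaceT.
Qed.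

End Words.

(** * The cone over a space *)

Section Cone.
Variables (X G : topologicalType) (g0 : G).
Hypothesis cg0 : closed [set g0].

(* A neighbourhood of the vertex is [X * U] with [U] a neighbourhood of [g0]. *)
Definition cone_nbhs (s : X * G) : set_system (X * G) :=
  [set A | exists V U, [/\ nbhs s.1 V, nbhs s.2 U &
     forall x g, (s.2 <> g0 -> V x) -> U g -> A (x, g)]].

Lemma cone_filter s : Filter (cone_nbhs s).
Proof.
split=> [|A B [V [U [xV gU VUA]]] [V' [U' [xV' gU' VUB]]]
         |A B AB [V [U [xV gU VUA]]]].
- by exists setT, setT; split=> //; exact: filterT.
- exists (V `&` V'), (U `&` U'); split; [exact: filterI|exact: filterI|].
  move=> x g VVx [Ug U'g].
  by split; [apply: VUA|apply: VUB] => // /VVx[].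
- by exists V, U; split=> // x g Vx Ug; apply/AB/VUA.
Qed.

Definition cone := from_nbhs cone_filter.

Lemma cone_regular : regular_space X -> regular_space G -> regular_space cone.
Proof.
move=> regX regG; apply/regular_spaceP => -[x g] A oA Axg.
have := oA; rewrite from_nbhs_openE => /(_ _ Axg) [V [U [/= xV gU VUA]]].
have [C cC [xC CV]] := regular_nbhs regX xV.
(* Away from the vertex the neighbourhood must avoid [g0], so that the first coordinate stays
   visible throughout it. *)
have gU' : nbhs g (U `&` [set g' | g <> g0 -> g' <> g0]).
  apply: filterI => //; have [->|gg0] := pselect (g = g0).
    by apply: filterE => g' /(_ erefl).
  by apply: filterS (open_nbhs_nbhs (conj (closed_openC cg0) gg0)) => g' ? _.
have [D cD [gD DU]] := regular_nbhs regG gU'.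
exists [set s | (g <> g0 -> C° s.1) /\ D° s.2],
  [set s | (g <> g0 -> C s.1) /\ D s.2].
split=> //.
- rewrite from_nbhs_openE => -[x' g'] /= [Cx' Dg'].
  exists [set x'' | g <> g0 -> C° x''], D°; split=> /=.
  + have [gg0|ngg0] := pselect (g = g0).
      by apply: filterE => x'' /(_ gg0).
    apply: filterS (open_nbhs_nbhs (conj (@open_interior _ C) (Cx' ngg0))).
    by move=> x'' ? _.
  + by apply: open_nbhs_nbhs; split=> //; exact: open_interior.
  + move=> x'' g'' g'g0 Dg''; split=> // gg0; apply: g'g0 => //.
    by have [_] := DU _ (interior_subset Dg'); exact.
- move=> [x' g'] /= [Cx' Dg']; split=> [/Cx'/interior_subset//|].
  exact: (interior_subset Dg').
- rewrite -openC from_nbhs_openE => -[x' g'] /= nF.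
  have [Dg'|nDg'] := pselect (D g'); last first.
    exists setT, (~` D); split=> /=; first exact: filterT.
      exact: open_nbhs_nbhs (conj (closed_openC cD) nDg').
    by move=> x'' g'' _ nD [_].
  have [gg0 nCx'] : g <> g0 /\ ~ C x'.
    by split=> [gg0|Cx']; apply: nF; split.
  exists (~` C), setT; split=> /=; last 1 first.
  + move=> x'' g'' nCx'' _ [/(_ gg0) Cx'' _]; apply: nCx'' Cx''.
    by have [_] := DU _ Dg'; exact.
  + exact: open_nbhs_nbhs (conj (closed_openC cC) nCx').
  + exact: filterT.
- move=> [x' g'] /= [Cx' Dg']; apply: VUA => [/Cx' /CV //|].
  by have [] := DU _ Dg'.
Qed.

Lemma cone_id_continuous : continuous (id : X * G -> cone).
Proof.
apply/continuousP => A; rewrite from_nbhs_openE openE => oA s /oA[V [U [xV gU VUA]]].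
by exists (V, U) => // -[x g] [/= Vx Ug]; exact: VUA.
Qed.

Lemma cone_rigid (R : realType) : [set: X] !=set0 ->
  rigid_space R G -> rigid_space R cone.
Proof.
move=> [x0 _] rG f cf; exists (f (x0, g0)) => -[x g].
have [|c fc] := rG (fun g => f (x, g)).
  move=> g'; apply: (@continuous_comp _ _ _ (fun g => (x, g) : cone) f).
    apply: (@continuous_comp _ (X * G)%type cone (fun g => (x, g)) id).
      by apply: cvg_pair => //; exact: cvg_cst.
    exact: cone_id_continuous.
  exact: cf.
rewrite fc -(fc g0).
apply: continuous_indistinguishable cf _ => A; rewrite from_nbhs_openE => oA.
by move=> /oA[V [U [/= xV gU VUA]]]; apply: VUA => //; exact: nbhs_singleton.
Qed.

Lemma cone_embedding g1 : g1 <> g0 ->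
  continuous (fun x => (x, g1) : cone) /\
  forall V : set X, open V ->
    exists2 W : set cone, open W & (fun x => (x, g1) : cone) @^-1` W = V.
Proof.
move=> g10; split.
  move=> x; apply: (@continuous_comp _ (X * G)%type cone (fun x => (x, g1)) id).
    by apply: cvg_pair => //; exact: cvg_cst.
  exact: cone_id_continuous.
move=> V oV; exists [set s | V s.1 /\ s.2 <> g0]; last first.
  by apply/seteqP; split=> x => [[]|].
rewrite from_nbhs_openE => -[x g] [/= Vx gg0].
exists V, [set~ g0]; split=> /=.
- exact: open_nbhs_nbhs.
- exact: open_nbhs_nbhs (conj (closed_openC cg0) gg0).
- by move=> x' g' /(_ gg0).
Qed.

Lemma cone_sequence_dense : (exists d, @sequence_dense X d) ->
  (exists d, @sequence_dense G d) -> exists d, @sequence_dense cone d.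
Proof.
move=> [d dd] [e de].
exists (fun n => if unpickle n is Some (i, j) then (d i, e j) else (d 0%N, e 0%N)).
move=> A oA [s As]; have := oA.
rewrite from_nbhs_openE => /(_ s As) [V [U [xV gU VUA]]].
have [|i Vi] := dd V° (open_interior _); first by exists s.1.
have [|j Uj] := de U° (open_interior _); first by exists s.2.
exists (pickle (i, j)); rewrite pickleK; apply: VUA => [_|];
  exact: interior_subset.
Qed.

Lemma cone_subsequence_compact : subsequence_compact X ->
  subsequence_compact G -> subsequence_compact cone.
Proof.
move=> sX sG s.
have [phi [K [hphi cK Kx]]] := sX (fun n => (s n).1).
have [psi [M [hpsi cM Mg]]] := sG (fun n => (s (phi n)).2).
exists (phi \o psi), ((id : X * G -> cone) @` (K `*` M)); split.
- by move=> m n mn /=; exact/hphi/hpsi.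
- apply: continuous_compact; last exact: compact_setX.
  by apply: continuous_subspaceT; exact: cone_id_continuous.
- by move=> n; exists (s (phi (psi n))).
Qed.

(** If no [W n] is everything, pick points outside and catch their second coordinates, along [phi],
    in a compact [K]. By the tube lemma the sets [V n] form an open cover of [X], so some [W N]
    contains [X * K], against the choice of the point of index [phi N]. *)
Lemma cone_countably_compact : countably_compact_space X ->
  subsequence_compact G -> countably_compact_space cone.
Proof.
move=> ccX sG U oU covU.
pose W n : set cone := \bigcup_(k in `I_n) U k.
have [[n Wn]|nW] := pselect (exists n, [set: cone] `<=` W n).
  exists (fset_set `I_n) => [k _|s /Wn [k kn Uks]]; first by rewrite inE.
  by exists k => //=; rewrite in_fset_set //; exact/mem_set.
have ex n : exists s, ~ W n s.
  apply: contrapT => ns; apply: nW; exists n => s _; apply: contrapT => nWs.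
  by apply: ns; exists s.
have [s sW] := choice ex.
have [phi [K [hphi cK Ks]]] := sG (fun n => (s n).2).
pose V n := [set x | forall g, K g -> W n (x, g)].
have oW n : open (W n) by apply: bigcup_open.
have cid := cone_id_continuous.
have oW' n : open ((W n) : set (X * G)).
  by move/continuousP: cid => /(_ (W n) (oW n)).
have oV n : open (V n).
  rewrite openE => x Vx.
  have := (compact_near_coveringP K).1 cK X (nbhs x) (fun x g => W n (x, g)) _.
  apply => g Kg; have := oW' n; rewrite openE => /(_ _ (Vx g Kg)).
  by move=> [[A B] [xA gB] ABW]; exists (B, A) => // -[g' x'] [/= ? ?]; exact: ABW.
have covV : [set: X] `<=` \bigcup_n V n.
  move=> x _.
  have := (compact_near_coveringP K).1 cK nat \oo (fun n g => W n (x, g)) _.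
  case=> [g Kg|N _ NK]; last by exists N => // g /NK; apply => /=.
  have [k _ Ukxg] := covU (x, g) I.
  have : open (U k : set (X * G)) by move/continuousP: cid => /(_ (U k) (oU k)).
  rewrite openE => /(_ _ Ukxg) [[A B] [xA gB] ABU].
  exists (B, [set n | (k < n)%N]); first by split=> //=; exact: nbhs_infty_gt.
  move=> [g' n] [/= Bg' kn]; exists k => //; apply: ABU; split=> //=.
  exact: nbhs_singleton.
have [D _ covD] := ccX V oV covV.
pose N := \max_(n <- finmap.enum_fset D) n.
have VN x : V N x.
  have [n /= nD Vx] := covD x I; move=> g /Vx [k /= kn Uk]; exists k => //=.
  apply: leq_trans kn _.
  exact: (@leq_bigmax_seq _ (finmap.enum_fset D) xpredT id n nD).
exfalso; apply: (sW (phi N)); have [k /= kN Uk] := VN (s (phi N)).1 _ (Ks N).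
exists k => /=; first exact: leq_trans kN (homo_ltn_id_le hphi N).
by move: Uk; rewrite -surjective_pairing.
Qed.

End Cone.

(** * The Kolmogorov quotient *)

Section Kolmogorov.
Variable S : topologicalType.

Definition indistinguishable (a b : S) := forall A, open A -> (A a <-> A b).

Definition canonical_rep (a : S) : S :=
  choose (fun b => `[< indistinguishable a b >]) a.

Lemma canonical_repP a : indistinguishable a (canonical_rep a).
Proof.
apply/asboolP; apply: (@chooseP S (fun b => `[< indistinguishable a b >])).
by apply/asboolP => A.
Qed.

Lemma canonical_rep_eq a b :
  indistinguishable a b -> canonical_rep a = canonical_rep b.
Proof.
move=> ab; rewrite /canonical_rep.
have /eq_choose -> : (fun c => `[< indistinguishable a c >]) =1
                     (fun c => `[< indistinguishable b c >]).
  move=> c; apply/asboolP/asboolP => h A oA.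
    by rewrite -(ab A oA); exact: h.
  by rewrite (ab A oA); exact: h.
by apply: choose_id; apply/asboolP => A oA; rewrite ?(ab A oA).
Qed.

Lemma kolmogorov_quotient : regular_space S ->
  exists (Q : topologicalType) (pi : S -> Q),
    [/\ regular_T1_space Q, continuous pi, forall y, exists x, pi x = y
      & forall W, open W -> exists2 W', open W' & pi @^-1` W' = W].
Proof.
(* The quotient is realised as the subspace of representatives; open sets are unions of classes, so
   the topologies agree. *)
move=> regS; pose Q := [set a : S | canonical_rep a = a].
have repQ a : canonical_rep a \in Q.
  by apply/mem_set/esym/canonical_rep_eq; exact: canonical_repP.
pose pi a : Q := exist _ (canonical_rep a) (repQ a).
have openQ (W : set S) : open W -> open (set_val @^-1` W : set Q).
  by move=> oW; exists W.
have piW (W : set S) : open W -> pi @^-1` (set_val @^-1` W) = W.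
  move=> oW; apply/seteqP; split=> a /=;
    by rewrite set_valE /= => /(canonical_repP a oW).
exists Q, pi; split.
- have regQ : regular_space Q.
    apply/regular_spaceP => a _ [W oW <-] Wa.
    have /regular_spaceP := regS => /(_ _ W oW Wa) [U [F [oU Ua UF cF FW]]].
    exists (set_val @^-1` U), (set_val @^-1` F); split=> //; first exact: openQ.
    + by move=> b; exact: UF.
    + by rewrite -openC; apply: (openQ (~` F)); exact: closed_openC.
    + by move=> b; exact: FW.
  split=> // a b /eqP nab.
  have [A [oA AaNb]] : exists A : set S,
      open A /\ ~ (A (set_val a) <-> A (set_val b)).
    apply: contrapT => nA; apply: nab; apply: val_inj => /=.
    have /set_mem <- := valP a; have /set_mem <- := valP b.
    apply: canonical_rep_eq => A oA; apply: contrapT => nAab; apply: nA.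
    by exists A.
  have [Aa|nAa] := pselect (A (set_val a)).
    exists (set_val @^-1` A); split; [exact: openQ|exact/mem_set|apply/mem_set].
    by move=> Ab; apply: AaNb.
  have Ab : A (set_val b) by apply: contrapT => nAb; apply: AaNb.
  (* Only [b] has a separating open set here; regularity reverses the roles through the complement
     of a closed set around [b]. *)
  have /regular_spaceP := regS => /(_ _ A oA Ab) [U [F [oU Ub UF cF FA]]].
  exists (set_val @^-1` (~` F)); split.
  + by apply: openQ; exact: closed_openC.
  + by apply/mem_set => /= /FA.
  + by apply/mem_set; apply; exact: UF.
- by apply/continuousP => _ [W oW <-]; rewrite piW.
- by move=> y; exists (set_val y); apply: val_inj => /=; exact: set_mem (valP y).
- by move=> W oW; exists (set_val @^-1` W); [exact: openQ|exact: piW].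
Qed.

End Kolmogorov.

(** * Embedding, separability and assembly of the construction *)

Lemma initial_embeds_in (X Z : topologicalType) (i : X -> Z) :
  accessible_space X -> continuous i ->
  (forall V, open V -> exists2 W, open W & i @^-1` W = V) -> embeds_in X Z.
Proof.
move=> T1 ci iV; exists (range i).
have iI : injective i.
  move=> x y ixy; apply: contrapT => /eqP /T1 [V [oV /set_mem Vx /set_mem nVy]].
  have [W oW WV] := iV V oV; move: Vx nVy; rewrite -WV /=.
  by rewrite ixy.
have ri x : i x \in range i by apply/mem_set; exists x.
have ex (z : range i) : exists x, i x = set_val z.
  by have /set_mem [x _ ix] := valP z; exists x.
have [g gP] := choice ex.
exists (fun x => exist _ (i x) (ri x)), g; split.
- by apply/continuousP => _ [W oW <-]; move/continuousP: ci => /(_ W oW).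
- apply/continuousP => V oV; have [W oW <-] := iV V oV.
  exists W => //; apply/seteqP.
  by split=> z /=; rewrite gP.
- by move=> x; apply: iI; rewrite gP.
- by move=> z; apply: val_inj => /=; rewrite gP.
Qed.

Lemma separable_sequence_dense (X : topologicalType) : [set: X] !=set0 ->
  separable_space X -> exists d, @sequence_dense X d.
Proof.
move=> [x0 _] [D /countable_injP[f fI] dD].
(* The numbers that are not codes of points of [D] get the default [x0]. *)
exists (fun n => xget x0 [set x | D x /\ f x = n]) => U oU U0.
have [x [Ux Dx]] := dD U U0 oU; exists (f x).
have [] : [set y | D y /\ f y = f x] (xget x0 [set y | D y /\ f y = f x]).
  by apply: xgetPex; exists x.
by move=> Dy fy; rewrite (fI _ _ _ _ fy) //; exact/mem_set.
Qed.

Lemma sequence_dense_separable (X : topologicalType) (d : nat -> X) :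
  sequence_dense d -> separable_space X.
Proof.
move=> dd; exists (range d); first exact: card_image_le.
by move=> U U0 oU; have [n Un] := dd U oU U0; exists (d n); split=> //; exists n.
Qed.

Lemma rigid_space_exists (R : realType) :
  exists (G : topologicalType) (g0 g1 : G),
    [/\ regular_space G, subsequence_compact G, exists d, @sequence_dense G d,
        rigid_space R G & closed [set g0] /\ g1 <> g0].
Proof.
have [T [H [L [[regT sT dT [cH cL HL]] nsep]]]] := nonseparated_space_exists.
pose J := jones H L.
pose p : J := jones_end _ _ false; pose q : J := jones_end _ _ true.
have cp : closed [set p] by exact: closed_jones_end.
have cq : closed [set q] by exact: closed_jones_end.
have pq : p <> q by exact: jones_ends_neq.
exists (words p q), (base_word p q p), (base_word p q q); split.
- by apply: words_regular => //; exact: jones_regular.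
- by apply: words_subsequence_compact; exact: jones_subsequence_compact.
- by apply: words_sequence_dense; exact: jones_sequence_dense.
- apply: words_rigid => // g cg; apply: jones_ends_eq cg => //.
  by move=> h e; exact: nsep.
- by split; [exact: closed_base_word|exact: base_word_neq].
Qed.

(** One space serves both statements: the Kolmogorov quotient of the cone. Since [pi] is onto and
    every open set of the cone is a preimage, each property passes to the quotient. *)
Lemma rigid_extension (R : realType) (X : topologicalType) :
  [set: X] !=set0 -> separable_space X -> regular_T1_space X ->
  exists RX : topologicalType,
    [/\ regular_T1_space RX, separable_space RX, rigid_space R RX, embeds_in X RX
      & (countably_compact_space X -> countably_compact_space RX) /\
        (subsequence_compact X -> subsequence_compact RX)].
Proof.
move=> X0 sepX [T1X regX].
have [G [g0 [g1 [regG sG dG rG [cg0 g10]]]]] := rigid_space_exists R.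
have dX := separable_sequence_dense X0 sepX.
have [Q [pi [regQ cpi pi_surj pi_open]]] :=
  kolmogorov_quotient (cone_regular cg0 regX regG).
have [ci iV] := @cone_embedding X G g0 cg0 g1 g10.
exists Q; split=> //.
- have [d dd] := cone_sequence_dense g0 dX dG.
  apply: (@sequence_dense_separable _ (pi \o d)) => U oU [y Uy].
  apply: (dd (pi @^-1` U)); first by move/continuousP: cpi; exact.
  by have [x xy] := pi_surj y; exists x; rewrite /= xy.
- move=> f cf; have [|c fc] := cone_rigid X0 rG (f := f \o pi).
    by move=> s; apply: continuous_comp; [exact: cpi|exact: cf].
  by exists c => y; have [x <-] := pi_surj y; exact: fc.
- apply: (@initial_embeds_in _ _ (pi \o (fun x => (x, g1) : cone X g0))) => //.
    by move=> x; apply: continuous_comp; [exact: ci|exact: cpi].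
  move=> V /iV[W oW <-]; have [W' oW' <-] := pi_open W oW.
  by exists W'.
- split=> [ccX|sX].
    move=> U oU covU.
    have [|s _|D sD covD] :=
      cone_countably_compact ccX sG (g0 := g0) (U := fun n => pi @^-1` U n).
    + by move=> n; move/continuousP: cpi; apply.
    + by have [n _ Un] := covU (pi s) I; exists n.
    + exists D => // y _; have [x <-] := pi_surj y.
      by have [n nD Un] := covD x I; exists n.
  move=> y; have [x xy] := choice pi_surj.
  have [phi [K [hphi cK Kx]]] := cone_subsequence_compact sX sG (x \o y).
  exists phi, (pi @` K); split=> //.
    by apply: continuous_compact => //; exact: continuous_subspaceT.
  by move=> n; exists (x (y (phi n))) => //; exact: Kx.
Qed.

Theorem theorem3p4 (R : realType) :
  (forall X : topologicalType,
     separable_space X -> regular_T1_space X -> ~ @normal_space X ->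
     countably_compact_space X ->
     exists RX : topologicalType,
       [/\ regular_T1_space RX, separable_space RX,
           countably_compact_space RX, rigid_space R RX & embeds_in X RX]) /\
  (forall X : topologicalType,
     separable_space X -> regular_T1_space X -> ~ @normal_space X ->
     totally_countably_compact_space X ->
     exists RX : topologicalType,
       [/\ regular_T1_space RX, separable_space RX,
           totally_countably_compact_space RX, rigid_space R RX
         & embeds_in X RX]).
Proof.
(* The empty space is normal, so [X] has a point. *)
have nonempty (X : topologicalType) : ~ normal_space X -> [set: X] !=set0.
  move=> nnX; apply/set0P/eqP => X0; apply: nnX => A _ B _.
  exists setT; first exact: filterT.
  move=> x _.
  by have : [set: X] x by []; rewrite X0.
split=> X sepX regX /nonempty X0.
  move=> ccX; have [RX [? ? ? ? [/(_ ccX) ? _]]] := rigid_extension R X0 sepX regX.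
  by exists RX.
move=> tX; have [RX [regRX ? ? ? [_ sRX]]] := rigid_extension R X0 sepX regX.
exists RX; split=> //.
apply: totally_of_subsequence_compact; first exact: regular_T1_hausdorff.
apply: sRX; apply: subsequence_compact_of_totally => //.
exact: regular_T1_hausdorff.
Qed.
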